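(* Let $k\ge1$ be a fixed integer and let $\xi$ be a real random variable with law $\mu$ satisfying $\mathbb E\xi=0$, $\mathbb E\xi^2=1$ and $\mathbb E\exp(t_0\xi^2)<\infty$ for some $t_0>0$. Suppose $p=p_n\ge1$ satisfies $p/\log n\to0$ as $n\to\infty$ and that the limit $$\kappa_\mu:=\lim_{x\to\infty}\frac{-\log\mathbb P(\xi^2>x)}{x}$$ exists and belongs to $(0,\infty)$. Then $$\frac{T_{n,k}}{k\log n}\longrightarrow\frac1{\kappa_\mu}\qquad\text{in probability as }n\to\infty.$$
   Context: $X=X_n=(\xi_{ij})_{1\le i\le p,\,1\le j\le n}\in\mathbb R^{p\times n}$ has i.i.d. entries that are copies of $\xi$. For $S\subset[n]=\{1,\dots,n\}$, $X_{[S]}$ is the submatrix formed by the columns indexed by $S$, and $$T_{n,k}:=\max_{S\subset[n],\,|S|=k}\lambda_{\max}\big(X_{[S]}^\top X_{[S]}\big).$$ *)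

(* Defs.v *)
From HB Require Import structures.
From mathcomp Require Import all_boot all_order all_algebra.
From mathcomp Require Import all_classical all_reals all_analysis.

Set Implicit Arguments.
Unset Strict Implicit.
Unset Printing Implicit Defensive.

Import Order.TTheory GRing.Theory Num.Theory.
Import numFieldNormedType.Exports.

Local Open Scope classical_set_scope.
Local Open Scope ring_scope.

Definition mutually_independent (d : measure_display) (T : measurableType d)
    (R : realType) (P : probability T R) (I : finType)
    (X : I -> {RV P >-> R}) : Prop :=
  forall (J : {set I}) (B : I -> set R), (forall i, measurable (B i)) ->
    P [set w | forall i, i \in J -> B i (X i w)]
    = (\prod_(i in J) P (X i @^-1` B i))%E.

(* The two variables may live on different probability spaces. *)
Definition same_law (d d' : measure_display) (T : measurableType d)
    (T' : measurableType d') (R : realType) (P : probability T R)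
    (P' : probability T' R) (X : {RV P >-> R}) (Y : {RV P' >-> R}) : Prop :=
  forall B : set R, measurable B -> distribution P X B = distribution P' Y B.

(* For a real symmetric matrix of positive size this supremum is a maximum,
   the set of eigenvalues being finite and nonempty. *)
Definition lambda_max (R : realType) (m : nat) (A : 'M[R]_m) : R :=
  sup [set a : R | eigenvalue A a].

Definition colsubmx (R : realType) (p n : nat) (X : 'M[R]_(p, n))
    (S : {set 'I_n}) : 'M[R]_(p, #|S|) :=
  colsub (fun j : 'I_#|S| => enum_val j) X.

(* Gram matrices have nonnegative eigenvalues, so the default value 0 of the
   iterated maximum only matters when there is no S, i.e. when n < k. *)
Definition Tmax (R : realType) (p n k : nat) (X : 'M[R]_(p, n)) : R :=
  \big[Num.max/0]_(S : {set 'I_n} | #|S| == k)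
    lambda_max ((colsubmx X S)^T *m colsubmx X S).

(* The n-th variable may live on its own probability space. *)
Definition cvg_in_probability (R : realType) (d : nat -> measure_display)
    (T : forall n, measurableType (d n)) (P : forall n, probability (T n) R)
    (Y : forall n, T n -> R) (l : R) : Prop :=
  forall e : R, 0 < e ->
    P n [set w | e < `|Y n w - l|] @[n --> \oo] --> 0%E.

(* Main.v *)
Require Import Defs.
From HB Require Import structures.
From mathcomp Require Import all_boot all_order all_algebra.
From mathcomp Require Import all_classical all_reals all_analysis.
From mathcomp Require Import measurable_realfun.
From mathcomp Require Import ring lra.

(** Two bounds on T, the maximum of the largest eigenvalues, reduce the theorem
    to one-dimensional large deviations.

    Upper bound. The largest eigenvalue of a Gram matrix is at most its trace,
    so T <= k max_j |X_j|^2, where X_j is the j-th column ([Tmax_le]). Each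
    |X_j|^2 is a sum of p independent squares whose tails are bounded by
    A exp (- (s + r) x) for every s + r < kappa; hence P(|X_j|^2 > b) is at most
    exp (- s b + O(p)) ([sum_sqr_tail]). As p = o(log n), the factor exp (O(p)) is
    n^o(1). For b = (1 / kappa + e) log n, choose s < kappa so close to kappa that
    s (1 / kappa + e) > 1; then the union bound over the n columns tends to zero
    ([Tmax_upper_tail], [upper_rate]).

    Lower bound. In one row, which is available since p >= 1, split the n entries
    into k blocks of size about n / k. A square exceeds c log n with probability
    at least n^(- b c), where c < 1 / kappa and b > kappa satisfy b c < 1, so with
    probability tending to one each block contains such an entry. The k columns
    through these entries have a Gram matrix whose largest eigenvalue exceeds
    k c log n, as the row itself shows when used as test vector ([Tmax_gt],
    [Tmax_lower_tail], [lower_rate]).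

    Both failure probabilities are O(n^(- eta)) for some eta > 0. The spectral
    input is the variational characterization of the largest eigenvalue
    ([lambda_max_gtP]), which also yields, through rational test vectors, the
    measurability of T ([measurable_Tmax]). *)

Import Order.TTheory GRing.Theory Num.Theory.
Import numFieldNormedType.Exports.

Local Open Scope classical_set_scope.
Local Open Scope ring_scope.

(** * The largest eigenvalue of a symmetric matrix *)

Definition bilin {R : realType} {m : nat} (A : 'M[R]_m) (u v : 'rV[R]_m) : R :=
  (u *m A *m v^T) 0 0.

Definition sqnorm {R : realType} {m : nat} (u : 'rV[R]_m) : R :=
  \sum_i u 0 i ^+ 2.

Lemma sqnorm_bilin {R : realType} {m : nat} (u : 'rV[R]_m) :
  sqnorm u = bilin 1%:M u u.
Proof.
rewrite /bilin mulmx1 mxE; apply: eq_bigr => i _.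
by rewrite mxE expr2.
Qed.

Lemma sqnorm_ge0 {R : realType} {m : nat} (u : 'rV[R]_m) : 0 <= sqnorm u.
Proof. by apply: sumr_ge0 => i _; rewrite sqr_ge0. Qed.

Lemma sqnorm_eq0 {R : realType} {m : nat} (u : 'rV[R]_m) :
  (sqnorm u == 0) = (u == 0).
Proof.
apply/idP/eqP => [|->]; last by rewrite /sqnorm big1// => i _; rewrite mxE expr0n.
rewrite psumr_eq0; last by move=> i _; exact: sqr_ge0.
move=> /allP h; apply/rowP => i; rewrite mxE.
by have := h i (mem_index_enum i); rewrite /= sqrf_eq0 => /eqP.
Qed.

Lemma sqnorm0 {R : realType} {m : nat} : sqnorm (0 : 'rV[R]_m) = 0.
Proof. by apply/eqP; rewrite sqnorm_eq0. Qed.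

Lemma sqnorm_gt0 {R : realType} {m : nat} (u : 'rV[R]_m) :
  (0 < sqnorm u) = (u != 0).
Proof. by rewrite lt_neqAle eq_sym sqnorm_eq0 sqnorm_ge0 andbT. Qed.

Lemma sqnormZ {R : realType} {m : nat} (a : R) (u : 'rV[R]_m) :
  sqnorm (a *: u) = a ^+ 2 * sqnorm u.
Proof. by rewrite /sqnorm big_distrr; apply: eq_bigr => i _; rewrite mxE exprMn. Qed.

Lemma bilinZ {R : realType} {m : nat} (A : 'M[R]_m) (a : R) (u : 'rV[R]_m) :
  bilin A (a *: u) (a *: u) = a ^+ 2 * bilin A u u.
Proof.
by rewrite /bilin linearZ/= -!scalemxAl -scalemxAr scalerA -expr2 mxE.
Qed.

Lemma bilin_line {R : realType} {m : nat} (A : 'M[R]_m) (u w : 'rV[R]_m) (t : R) :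
  A^T = A ->
  bilin A (u + t *: w) (u + t *: w) =
  bilin A u u + 2 * t * bilin A u w + t ^+ 2 * bilin A w w.
Proof.
move=> sA.
have sym : bilin A w u = bilin A u w.
  have : u *m A *m w^T = (w *m A *m u^T)^T by rewrite !trmx_mul trmxK sA mulmxA.
  by rewrite /bilin => ->; rewrite [RHS]mxE.
have -> : bilin A (u + t *: w) (u + t *: w) =
    bilin A u u + t * bilin A u w + t * (bilin A w u + t * bilin A w w).
  rewrite /bilin linearD/= linearZ/= mulmxDl mulmxDr !mulmxDl.
  rewrite -!scalemxAl -!scalemxAr.
  move: (u *m A *m u^T) (u *m A *m w^T) (w *m A *m u^T) (w *m A *m w^T).
  by move=> a b c d; rewrite !mxE; ring.
by rewrite sym; ring.
Qed.

Lemma continuous_bilin {R : realType} {m : nat} (A : 'M[R]_m) :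
  continuous (fun v => bilin A v v).
Proof.
have -> : (fun v => bilin A v v) =
    fun v : 'rV[R]_m => \sum_i (\sum_j v 0 j * A j i) * v 0 i.
  by apply/funext => w; rewrite /bilin mxE; apply: eq_bigr => i _; rewrite !mxE.
have cc i : continuous (fun w : 'rV[R]_m => w 0 i) by exact: coord_continuous.
have FF (v : 'rV[R]_m) : Filter (nbhs v) by exact: nbhs_filter.
move=> v; apply: (@cvg_big _ _ _ _ _ _ _ (nbhs v)) => [|i _].
  exact: add_continuous.
apply: cvgM; last exact: cc.
apply: (@cvg_big _ _ _ _ _ _ _ (nbhs v)) => [|j _]; first exact: add_continuous.
by apply: cvgM; [exact: cc|exact: cvg_cst].
Qed.

(** The form of a I - A is nonnegative and vanishes at u. Moving from u in the
    direction - w, with w = u (a I - A), changes it by - 2 t |w|^2 + O(t^2),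
    which would be negative for small t > 0 if w were nonzero. *)
Lemma eigenvector_of_max {R : realType} {m : nat} (A : 'M[R]_m) (a : R)
    (u : 'rV[R]_m) :
  A^T = A -> (forall v, bilin A v v <= a * sqnorm v) ->
  bilin A u u = a * sqnorm u -> u *m A = a *: u.
Proof.
move=> sA le_a eq_a.
pose B := a%:M - A.
have BE v : bilin B v v = a * sqnorm v - bilin A v v.
  rewrite sqnorm_bilin /bilin /B mulmxBr mulmxBl mulmx1 mul_mx_scalar -scalemxAl.
  by move: (v *m v^T) (v *m A *m v^T) => b c; rewrite !mxE.
have sB : B^T = B by rewrite /B linearB/= tr_scalar_mx sA.
pose w := u *m B.
have uw : bilin B u w = sqnorm w.
  by rewrite sqnorm_bilin /bilin mulmx1.
suff : w = 0.
  by rewrite /w /B mulmxBr mul_mx_scalar => /eqP; rewrite subr_eq0 => /eqP.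
apply/eqP; rewrite -sqnorm_eq0; apply/eqP.
have c0 v : 0 <= bilin B v v by rewrite BE subr_ge0.
have Bu : bilin B u u = 0 by rewrite BE eq_a subrr.
have s0 := sqnorm_ge0 w; have cw := c0 w.
set s := sqnorm w in uw s0 *; set c := bilin B w w in cw.
have c1 : 0 < c + 1 by rewrite ltr_wpDl.
(* This step length makes the first order term dominate unless w = 0. *)
have := c0 (u + (- (s / (c + 1))) *: w).
rewrite bilin_line// Bu uw add0r -/c.
have -> : 2 * - (s / (c + 1)) * s + (- (s / (c + 1))) ^+ 2 * c =
   - (s ^+ 2 * ((c + 2) / (c + 1) ^+ 2)).
  by field; rewrite gt_eqF.
rewrite oppr_ge0 pmulr_lle0; last by rewrite divr_gt0// ?exprn_gt0// ltr_wpDl.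
by move=> h; apply/eqP; rewrite -sqrf_eq0 eq_le h sqr_ge0.
Qed.

(** The Rayleigh quotient is maximal at a maximum point of the form on the
    compact unit sphere, by homogeneity. *)
Lemma exists_max_bilin {R : realType} {m : nat} (A : 'M[R]_m) : (0 < m)%N ->
  exists a, exists u, [/\ u != 0, bilin A u u = a * sqnorm u &
    forall v, bilin A v v <= a * sqnorm v].
Proof.
move=> m0.
pose S := [set v : 'rV[R]_m | sqnorm v = 1].
have S0 : S !=set0.
  exists (delta_mx 0 (Ordinal m0)); rewrite /S/= /sqnorm (bigD1 (Ordinal m0))//=.
  rewrite big1 => [|i /negPf ni]; first by rewrite mxE !eqxx expr1n addr0.
  by rewrite mxE eqxx ni expr0n.
have cS : compact S.
  apply: bounded_closed_compact.
    exists 1; split; first exact: num_real.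
    move=> M M1 v /= Sv; rewrite [leLHS]mx_normrE.
    apply: bigmax_le; first by rewrite ltW// (lt_trans _ M1).
    move=> [i j] _ /=; rewrite (ord1 i); apply: (le_trans _ (ltW M1)).
    rewrite -(@expr_le1 _ 2)// -normrX ger0_norm ?sqr_ge0//.
    by rewrite -Sv /sqnorm (bigD1 j)//= lerDl sumr_ge0// => k _; rewrite sqr_ge0.
  have -> : S = (fun v => bilin 1%:M v v) @^-1` [set 1].
    by apply/seteqP; split => v; rewrite /S/= sqnorm_bilin.
  apply: closed_comp; last exact: closed_eq.
  by move=> v _; exact: continuous_bilin.
have [u] := @EVT_max_rV R m (fun v => bilin A v v) S S0 cS
  (continuous_subspaceT (continuous_bilin A)).
rewrite inE => Su umax; exists (bilin A u u), u; split.
- by rewrite -sqnorm_eq0 Su oner_eq0.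
- by rewrite Su mulr1.
move=> v; have [->|v0] := eqVneq v 0.
  by rewrite /bilin !mul0mx mxE sqnorm0 mulr0.
have sv : 0 < sqnorm v by rewrite lt_neqAle eq_sym sqnorm_eq0 v0 sqnorm_ge0.
have := umax ((Num.sqrt (sqnorm v))^-1 *: v).
rewrite inE /S/= sqnormZ bilinZ exprVn sqr_sqrtr ?sqnorm_ge0// mulVf ?gt_eqF//.
by move=> /(_ erefl); rewrite mulrC ler_pdivrMr.
Qed.

Lemma eigenvalue_bilin {R : realType} {m : nat} (A : 'M[R]_m) (a : R) :
  eigenvalue A a -> exists2 v, v != 0 & bilin A v v = a * sqnorm v.
Proof.
move=> /eigenvalueP[v vA v0]; exists v => //.
by rewrite sqnorm_bilin /bilin vA mulmx1 -scalemxAl [LHS]mxE.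
Qed.

(** Variational characterization: the maximal Rayleigh quotient is itself an
    eigenvalue, and no eigenvalue exceeds it. In this form both bounds on Gram
    matrices and the measurability of the largest eigenvalue follow by
    inspecting the form on single vectors. *)
Lemma lambda_max_gtP {R : realType} {m : nat} (A : 'M[R]_m) (c : R) :
  (0 < m)%N -> A^T = A ->
  c < lambda_max A <-> exists v, c * sqnorm v < bilin A v v.
Proof.
move=> m0 sA; have [a [u [u0 ua amax]]] := exists_max_bilin A m0.
have ea : eigenvalue A a.
  by apply/eigenvalueP; exists u => //; exact: eigenvector_of_max.
have ub : ubound [set b | eigenvalue A b] a.
  move=> b /= /eigenvalue_bilin[v v0 vb].
  by have := amax v; rewrite vb ler_pM2r// sqnorm_gt0.
have -> : lambda_max A = a.
  apply/eqP; rewrite eq_le /lambda_max; apply/andP; split.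
    by apply: ge_sup => //; exists a.
  by apply: ub_le_sup => //; exists a.
split=> [ca|[v cv]].
  by exists u; rewrite ua ltr_pM2r// sqnorm_gt0.
have v0 : v != 0.
  apply: contraTneq cv => ->.
  by rewrite /bilin !mul0mx mxE sqnorm0 mulr0 ltxx.
by rewrite -(@ltr_pM2r _ (sqnorm v)) ?sqnorm_gt0// (lt_le_trans cv).
Qed.

(** * Gram matrices and the maximum over column subsets *)

Lemma gram_sym {R : realType} {p m : nat} (Y : 'M[R]_(p, m)) :
  (Y^T *m Y)^T = Y^T *m Y.
Proof. by rewrite trmx_mul trmxK. Qed.

Lemma bilin_gram {R : realType} {p m : nat} (Y : 'M[R]_(p, m)) (v : 'rV[R]_m) :
  bilin (Y^T *m Y) v v = \sum_i (\sum_j Y i j * v 0 j) ^+ 2.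
Proof.
have -> : bilin (Y^T *m Y) v v = sqnorm (v *m Y^T).
  by rewrite sqnorm_bilin /bilin mulmx1 trmx_mul trmxK !mulmxA.
apply: eq_bigr => i _; rewrite mxE; congr (_ ^+ 2).
by apply: eq_bigr => j _; rewrite mxE mulrC.
Qed.

(** Lagrange's identity: the difference of the two sides is half the sum of
    the squares (a_i b_j - a_j b_i)^2. *)
Lemma sum_cauchy_schwarz {R : realType} {m : nat} (a b : 'I_m -> R) :
  (\sum_j a j * b j) ^+ 2 <= (\sum_j a j ^+ 2) * (\sum_j b j ^+ 2).
Proof.
have : 0 <= \sum_i \sum_j (a i * b j - a j * b i) ^+ 2.
  by apply: sumr_ge0 => i _; apply: sumr_ge0 => j _; exact: sqr_ge0.
have -> : \sum_i \sum_j (a i * b j - a j * b i) ^+ 2 =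
   \sum_i \sum_j a i ^+ 2 * b j ^+ 2 + \sum_i \sum_j a j ^+ 2 * b i ^+ 2
   - (\sum_i \sum_j (a i * b i) * (a j * b j)) *+ 2.
  rewrite -big_split -sumrMnl -sumrB; apply: eq_bigr => i _ /=.
  rewrite -big_split -sumrMnl -sumrB; apply: eq_bigr => j _ /=; ring.
rewrite [X in _ + X - _]exchange_big/= -big_distrlr/= -big_distrlr/= -expr2.
lra.
Qed.

(** By Cauchy-Schwarz in each row, the form |Y v|^2 is at most the trace of
    the Gram matrix times |v|^2. Discarding all but the trace is affordable for T:
    the sum of the k squared column norms already matches the lower bound to
    leading order. *)
Lemma lambda_max_gram_le {R : realType} {p m : nat} (Y : 'M[R]_(p, m)) :
  (0 < m)%N ->
  lambda_max (Y^T *m Y) <= \sum_i \sum_j Y i j ^+ 2.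
Proof.
move=> m0; rewrite leNgt; apply/negP => /(lambda_max_gtP _ _ m0 (gram_sym Y)).
move=> [v]; rewrite bilin_gram ltNge => /negP; apply.
rewrite big_distrl/=; apply: ler_sum => i _; exact: sum_cauchy_schwarz.
Qed.

(** The row itself, used as test vector v, gives |Y v|^2 >= |v|^4 > c |v|^2. *)
Lemma lambda_max_gram_gt_row {R : realType} {p m : nat} (Y : 'M[R]_(p, m))
    (i : 'I_p) (c : R) :
  (0 < m)%N -> 0 <= c -> c < \sum_j Y i j ^+ 2 -> c < lambda_max (Y^T *m Y).
Proof.
move=> m0 c0 cY; apply/(lambda_max_gtP _ _ m0 (gram_sym Y)).
have sE : \sum_j Y i j ^+ 2 = sqnorm (row i Y).
  by apply: eq_bigr => j _; rewrite mxE.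
rewrite sE in cY; exists (row i Y); rewrite bilin_gram (bigD1 i)//=.
apply: (@lt_le_trans _ _ (sqnorm (row i Y) ^+ 2)).
  by rewrite expr2 ltr_pM2r// (le_lt_trans c0).
rewrite -[leLHS]addr0 lerD ?sumr_ge0// => [|? _]; last exact: sqr_ge0.
rewrite le_eqVlt; apply/orP; left; apply/eqP; congr (_ ^+ 2).
by apply: eq_bigr => j _; rewrite mxE expr2.
Qed.

Lemma Tmax_le {R : realType} {p n k : nat} (X : 'M[R]_(p, n)) (b : R) :
  (0 < k)%N -> 0 <= b -> (forall j, \sum_i X i j ^+ 2 <= b) ->
  Tmax k X <= k%:R * b.
Proof.
move=> k0 b0 Xb; apply: bigmax_le => [|S /eqP Sk]; first by rewrite mulr_ge0.
apply: le_trans (lambda_max_gram_le _ _) _; first by rewrite Sk.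
rewrite exchange_big/= -[X in X%:R * _]Sk -[X in X%:R * _]card_ord.
rewrite mulr_natl -sumr_const; apply: ler_sum => j _; rewrite (le_trans _ (Xb (enum_val j)))//.
by apply: ler_sum => i _; rewrite mxE.
Qed.

(** If k entries of a single row are large then the columns through them form
    a submatrix whose row alone has squared norm above k x. *)
Lemma Tmax_gt {R : realType} {p n k : nat} (X : 'M[R]_(p, n)) (i : 'I_p)
    (S : {set 'I_n}) (x : R) :
  (0 < k)%N -> #|S| = k -> 0 <= x -> (forall j, j \in S -> x < X i j ^+ 2) ->
  k%:R * x < Tmax k X.
Proof.
move=> k0 Sk x0 Sx; apply: lt_le_trans (le_bigmax_cond _ _ (_ : #|S| == k)).
  2: by rewrite Sk.
apply: (lambda_max_gram_gt_row _ i); rewrite ?Sk// ?mulr_ge0//.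
rewrite -[X in X%:R * _]Sk -[X in X%:R * _]card_ord mulr_natl -sumr_const.
apply: ltr_sum => [|j _]; last by rewrite mxE; apply: Sx; exact: enum_valP.
have S0 : (0 < #|S|)%N by rewrite Sk.
by apply/hasP; exists (Ordinal S0); rewrite ?mem_index_enum.
Qed.

(** * Measurability of the largest eigenvalue *)

Lemma measurable_set_lt {R : realType} {d : measure_display}
    {T : measurableType d} (f g : T -> R) :
  measurable_fun setT f -> measurable_fun setT g ->
  measurable [set w | f w < g w].
Proof.
move=> mf mg; rewrite -[X in measurable X]setTI.
have := @measurable_fun_ltr _ _ _ _ _ _ mf mg measurableT [set true].
by rewrite preimage_true; exact.
Qed.

Lemma measurable_set_le {R : realType} {d : measure_display}
    {T : measurableType d} (f g : T -> R) :
  measurable_fun setT f -> measurable_fun setT g ->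
  measurable [set w | f w <= g w].
Proof.
move=> mf mg; rewrite -[X in measurable X]setTI.
have := @measurable_fun_ler _ _ _ _ _ _ mf mg measurableT [set true].
by rewrite preimage_true; exact.
Qed.

Lemma rV_dense_rat {R : realType} {m : nat} (v : 'rV[R]_m) (U : set 'rV[R]_m) :
  nbhs v U -> exists q : 'rV[rat]_m, U (map_mx ratr q).
Proof.
move=> /nbhs_ballP[e /= e0 vU].
have near_rat j : exists q : rat, ball (v 0 j) e (ratr q : R).
  have := @rat_in_itvoo R (v 0 j) (v 0 j + e); rewrite ltrDl => /(_ e0)[q].
  rewrite in_itv/= => /andP[vq qv]; exists q.
  by rewrite /ball/= ltr_distlC; lra.
have [f fP] := choice near_rat.
exists (\row_j f j); apply: vU; split=> // i j; rewrite (ord1 i) !mxE; exact: fP.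
Qed.

(** The inequality for the form is an open condition on the vector, so a
    rational vector satisfies it as soon as a real one does. The countable
    existential is what makes the largest eigenvalue measurable. *)
Lemma lambda_max_gt_ratP {R : realType} {m : nat} (A : 'M[R]_m) (c : R) :
  (0 < m)%N -> A^T = A ->
  c < lambda_max A <->
  exists q : 'rV[rat]_m, c * sqnorm (map_mx ratr q : 'rV[R]_m) <
    bilin A (map_mx ratr q) (map_mx ratr q).
Proof.
move=> m0 sA; rewrite lambda_max_gtP//; split=> [[v cv]|[q cq]]; last first.
  by exists (map_mx ratr q).
pose f (v : 'rV[R]_m) := bilin (A - c%:M) v v.
have fE w : f w = bilin A w w - c * sqnorm w.
  rewrite /f sqnorm_bilin /bilin mulmxBr mulmxBl mulmx1 mul_mx_scalar -scalemxAl.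
  by move: (w *m w^T) (w *m A *m w^T) => b d; rewrite !mxE.
have /rV_dense_rat[q] : nbhs v (f @^-1` [set x | 0 < x]).
  apply: (continuous_bilin (A - c%:M) v).
  by apply: (open_nbhs_nbhs); split; [exact: open_gt|rewrite /= -/(f v) fE subr_gt0].
by rewrite /= fE subr_gt0 => cq; exists q.
Qed.

Lemma measurable_lambda_max {R : realType} {d : measure_display}
    {T : measurableType d} {m : nat} (A : T -> 'M[R]_m) :
  (0 < m)%N -> (forall w, (A w)^T = A w) ->
  (forall i j, measurable_fun setT (fun w => A w i j)) ->
  measurable_fun setT (fun w => lambda_max (A w)).
Proof.
move=> m0 sA mA _.
apply: (measurability _ (measurable_realfun.RGenOInfty.measurableE R)) => //.
move=> _ [_ [c ->] <-]; rewrite setTI.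
have -> : (fun w => lambda_max (A w)) @^-1` `]c, +oo[ =
  \bigcup_(q : 'rV[rat]_m)
    [set w | c * sqnorm (map_mx ratr q : 'rV[R]_m) <
             bilin (A w) (map_mx ratr q) (map_mx ratr q)].
  apply/seteqP; split=> w /=; rewrite in_itv/= andbT lambda_max_gt_ratP//.
    by move=> [q cq]; exists q.
  by move=> [q _ cq]; exists q.
apply: countable_bigcupT_measurable => // q.
apply: measurable_set_lt => //.
rewrite /bilin; under eq_fun do rewrite mxE.
apply: measurable_sum => i; apply: measurable_funM => //.
under eq_fun do rewrite mxE.
by apply: measurable_sum => j; apply: measurable_funM.
Qed.

Lemma measurable_bigmax {R : realType} {d : measure_display}
    {T : measurableType d} {I : Type} (s : seq I) (Q : pred I)
    (f : I -> T -> R) (x : R) :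
  (forall i, Q i -> measurable_fun setT (f i)) ->
  measurable_fun setT (fun w => \big[Num.max/x]_(i <- s | Q i) f i w).
Proof.
move=> mf; elim: s => [|i s ih].
  under eq_fun do rewrite big_nil.
  exact: measurable_cst.
case Qi: (Q i); under eq_fun do rewrite big_cons Qi; last exact: ih.
by apply: measurable_maxr => //; exact: mf.
Qed.

Lemma measurable_Tmax {R : realType} {d : measure_display}
    {T : measurableType d} {p n k : nat} (X : T -> 'M[R]_(p, n)) :
  (0 < k)%N -> (forall i j, measurable_fun setT (fun w => X w i j)) ->
  measurable_fun setT (fun w => Tmax k (X w)).
Proof.
move=> k0 mX; rewrite /Tmax; apply: measurable_bigmax => S /eqP Sk.
apply: measurable_lambda_max => [|w|i j]; [by rewrite Sk|exact: gram_sym|].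
under eq_fun do rewrite mxE.
apply: measurable_sum => l.
by under eq_fun do rewrite !mxE; apply: measurable_funM; exact: mX.
Qed.

Lemma measurable_Tmax_entries {R : realType} {d : measure_display}
    {T : measurableType d} {P : probability T R} {p n k : nat}
    (X : 'I_p -> 'I_n -> {RV P >-> R}) :
  (0 < k)%N ->
  measurable_fun setT (fun w => Tmax k (\matrix_(i, j) X i j w)).
Proof.
move=> k0; apply: measurable_Tmax => // i j; under eq_fun do rewrite mxE.
exact: measurable_funPT.
Qed.

(** * Independent families with exponential tails *)

Lemma union_bound {R : realType} {d : measure_display} {T : measurableType d}
    (P : probability T R) {I : finType} (Q : pred I) (A : set T)
    (E : I -> set T) :
  measurable A -> (forall i, measurable (E i)) ->
  (forall w, A w -> exists2 i, Q i & E i w) ->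
  (P A <= \sum_(i | Q i) P (E i))%E.
Proof.
move=> mA mE AE; pose U := \big[setU/set0]_(i | Q i) E i.
have [mU PU] : measurable U /\ (P U <= \sum_(i | Q i) P (E i))%E.
  rewrite /U; elim/big_rec2: _ => [|i y B _ [mB PB]]; first by rewrite measure0.
  split; first exact: measurableU.
  by rewrite (le_trans (measureU2 _ _ _))//= leeD2l.
apply: le_trans PU; apply: le_measure; rewrite ?inE// => w /AE[i Qi Eiw].
by rewrite /U (bigD1 i)//=; left.
Qed.

Lemma measurable_rectangle {R : realType} {d : measure_display}
    {T : measurableType d} {I : finType} (X : I -> T -> R) (J : {set I})
    (B : I -> set R) :
  (forall i, measurable_fun setT (X i)) -> (forall i, measurable (B i)) ->
  measurable [set w | forall i, i \in J -> B i (X i w)].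
Proof.
move=> mX mB.
have -> : [set w | forall i, i \in J -> B i (X i w)] =
    \bigcap_(i in [set` J]) (X i @^-1` B i).
  by apply/seteqP; split.
apply: fin_bigcap_measurable; first exact: finite_finset.
by move=> i _; rewrite -[X in measurable X]setTI; exact: mX.
Qed.

Lemma indep_prod_le {R : realType} {d : measure_display}
    {T : measurableType d} (P : probability T R) {I : finType}
    (X : I -> {RV P >-> R}) (J : {set I}) (B : I -> set R) (b : I -> R) :
  mutually_independent X -> (forall i, measurable (B i)) ->
  (forall i, i \in J -> (P (X i @^-1` B i) <= (b i)%:E)%E) ->
  (P [set w | forall i, i \in J -> B i (X i w)] <= (\prod_(i in J) b i)%:E)%E.
Proof.
move=> indX mB PB; rewrite indX//.
pose K (x : \bar R) (y : R) := (0 <= x)%E /\ (x <= y%:E)%E.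
suff [] : K (\prod_(i in J) P (X i @^-1` B i))%E (\prod_(i in J) b i) by [].
apply: (big_ind2 K) => [|x y x' y' [x0 xy] [x0' xy']|i iJ].
- by split; rewrite ?lee01.
- by split; [exact: mule_ge0|rewrite EFinM; exact: lee_pmul].
- by split; [exact: measure_ge0|exact: PB].
Qed.

Lemma geometric_sum_le {R : realType} (r : R) (M : nat) : 0 < r ->
  \sum_(m < M) expR (- (r * m%:R)) <= (1 - expR (- r))^-1.
Proof.
move=> r0; have e1 : 0 < 1 - expR (- r) by rewrite subr_gt0 expR_lt1 oppr_lt0.
rewrite -[leRHS]mul1r ler_pdivlMr// mulrC.
under eq_bigr do rewrite -mulNr expRM_natr.
have := subrX1 (expR (- r)) M; rewrite -opprB -[X in _ = X * _]opprB mulNr => /oppr_inj <-.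
by rewrite gerBl exprn_ge0// expR_ge0.
Qed.

(** An exponential Chebyshev bound obtained by counting, without expectations.
    If the sum is at least M + #|J| then the integer parts of the squares sum to
    at least M. A union bound over the possible vectors f of integer parts
    (capped at M), independence, and the exponential tails bound the probability
    by the sum over f of the products of A exp (- (s + r) f i). As f sums to at
    least M, this is at most exp (- s M) times a product of #|J| geometric series
    of ratio exp (- r). *)
Lemma sum_sqr_tail {R : realType} {d : measure_display}
    {T : measurableType d} (P : probability T R) {I : finType}
    (X : I -> {RV P >-> R}) (J : {set I}) (A s r : R) (M : nat) :
  mutually_independent X -> 0 <= A -> 0 <= s -> 0 < r ->
  (forall i (m : nat), i \in J ->
    (P [set w | (m%:R <= X i w ^+ 2)%R] <= (A * expR (- ((s + r) * m%:R)))%:E)%E) ->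
  (P [set w | (M%:R + #|J|%:R <= \sum_(i in J) X i w ^+ 2)%R]
    <= (expR (- (s * M%:R)) * (A / (1 - expR (- r))) ^+ #|J|)%:E)%E.
Proof.
move=> indX A0 s0 r0 tail.
pose Q (f : {ffun I -> 'I_M.+1}) :=
  (f \in pffun_on ord0 (mem J) predT) && (M <= \sum_(i in J) f i)%N.
pose B (f : {ffun I -> 'I_M.+1}) (i : I) : set R := [set x | (f i)%:R <= x ^+ 2].
pose E f := [set w | forall i, i \in J -> B f i (X i w)].
have mB f i : measurable (B f i).
  by apply: measurable_set_le => //; exact: measurable_funX.
have mX2 i : measurable_fun setT (fun w => X i w ^+ 2) by exact: measurable_funX.
have PE f : (P (E f) <= (\prod_(i in J) (A * expR (- ((s + r) * (f i)%:R))))%:E)%E.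
  by apply: indep_prod_le => // i iJ; exact: tail.
apply: le_trans (union_bound P Q _ E _ _ _) _.
- apply: measurable_set_le => //.
  by under eq_fun do rewrite big_mkcond; apply: measurable_sum => i; case: (i \in J).
- by move=> f; apply: measurable_rectangle.
- move=> w /= Mle.
  (* The integer parts, cut off at M so that they range over a finite set. *)
  pose f := [ffun i => if i \in J then
    inord (minn (Num.truncn (X i w ^+ 2)) M) : 'I_M.+1 else ord0].
  have fE i : i \in J -> f i = minn (Num.truncn (X i w ^+ 2)) M :> nat.
    by move=> iJ; rewrite ffunE iJ inordK// ltnS geq_minr.
  exists f; last first.
    move=> i iJ /=; rewrite /B/= fE//.
    rewrite (@le_trans _ _ (Num.truncn (X i w ^+ 2))%:R) ?ler_nat ?geq_minl//.
    by rewrite truncn_le// sqr_ge0.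
  rewrite /Q; apply/andP; split.
    apply/pffun_onP; split=> //; apply/supportP => i iJ.
    by rewrite ffunE (negPf iJ).
  have [[i iJ Mi]|allM] := pselect (exists2 i, i \in J & (M <= Num.truncn (X i w ^+ 2))%N).
    by rewrite (bigD1 i)//= fE// (minn_idPr _)// leq_addr.
  rewrite -(@ler_nat R) natr_sum -(lerD2r #|J|%:R) (le_trans Mle)//.
  rewrite -sum1_card natr_sum -big_split/=; apply: ler_sum => i iJ.
  rewrite fE// (minn_idPl _); last first.
    by rewrite leqNgt; apply/negP => /ltnW Mi; apply: allM; exists i.
  by rewrite natr1 ltW// truncnS_gt.
(* On the index set of the union the sum of f over J is at least M, so part s
   of the exponent yields exp (- s M); the remaining sum over all f factors. *)
apply: (@le_trans _ _ (\sum_(f in pffun_on (ord0 : 'I_M.+1) (mem J) predT)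
    expR (- (s * M%:R)) * \prod_(i in J) (A * expR (- (r * (f i)%:R))))%:E).
  rewrite -sumEFin/= big_mkcondr/=; apply: lee_sum => f _.
  case: ifP => Mf; last first.
    rewrite lee_fin mulr_ge0 ?expR_ge0// prodr_ge0// => i _.
    by rewrite mulr_ge0 ?expR_ge0.
  apply: le_trans (PE f) _; rewrite lee_fin.
  have -> : \prod_(i in J) (A * expR (- ((s + r) * (f i)%:R))) =
    expR (- (s * (\sum_(i in J) f i)%N%:R)) * \prod_(i in J) (A * expR (- (r * (f i)%:R))).
    rewrite natr_sum mulr_sumr -sumrN expR_sum -big_split/=.
    by apply: eq_bigr => i _; rewrite mulrCA -expRD -opprD -mulrDl.
  rewrite ler_wpM2r//; first by rewrite prodr_ge0// => i _; rewrite mulr_ge0 ?expR_ge0.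
  by rewrite ler_expR lerN2 ler_wpM2l// ler_nat.
rewrite lee_fin -mulr_sumr ler_wpM2l ?expR_ge0//.
rewrite -(big_distr_big ord0 (mem J) predT (fun i m => A * expR (- (r * m%:R))))/=.
rewrite -prodr_const; apply: ler_prod => i _; apply/andP; split.
  by apply: sumr_ge0 => m _; rewrite mulr_ge0 ?expR_ge0.
by rewrite -mulr_sumr ler_wpM2l// geometric_sum_le.
Qed.

Lemma all_small_le {R : realType} {d : measure_display}
    {T : measurableType d} (P : probability T R) {I : finType}
    (X : I -> {RV P >-> R}) (J : {set I}) (x q : R) :
  mutually_independent X ->
  (forall i, i \in J -> (q%:E <= P [set w | (x < X i w ^+ 2)%R])%E) ->
  (P [set w | forall i, i \in J -> (X i w ^+ 2 <= x)%R]
    <= (expR (- q) ^+ #|J|)%:E)%E.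
Proof.
move=> indX tail; rewrite -prodr_const.
apply: (@indep_prod_le _ _ _ _ _ _ _ (fun=> [set y | y ^+ 2 <= x])) => // [i|i iJ].
  by apply: measurable_set_le => //; exact: measurable_funX.
have -> : X i @^-1` [set y | y ^+ 2 <= x] = ~` [set w | x < X i w ^+ 2].
  by apply/seteqP; split=> w /=; rewrite leNgt => /negP.
have mA : measurable [set w | x < X i w ^+ 2].
  by apply: measurable_set_lt => //; exact: measurable_funX.
rewrite probability_setC//; move: (tail i iJ).
rewrite -[P _]fineK ?fin_num_measure// -EFinB !lee_fin => qP.
by have := expR_ge1Dx (- q); lra.
Qed.

(** * Deviation bounds at fixed dimensions *)

(** A large maximum forces one of the n columns to have squared norm above b,
    and the p squares in a column are independent with exponential tails. *)
Lemma Tmax_upper_tail {R : realType} {d : measure_display}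
    {T : measurableType d} {P : probability T R} {p n k : nat}
    (X : 'I_p -> 'I_n -> {RV P >-> R}) (A s r b : R) (M : nat) :
  (0 < k)%N -> mutually_independent (fun ij : 'I_p * 'I_n => X ij.1 ij.2) ->
  0 <= A -> 0 <= s -> 0 < r -> M%:R + p%:R <= b ->
  (forall i j (m : nat),
    (P [set w | (m%:R <= X i j w ^+ 2)%R]
      <= (A * expR (- ((s + r) * m%:R)))%:E)%E) ->
  (P [set w | (k%:R * b < Tmax k (\matrix_(i, j) X i j w))%R]
    <= (n%:R * (expR (- (s * M%:R)) * (A / (1 - expR (- r))) ^+ p))%:E)%E.
Proof.
move=> k_gt0 indX A0 s0 r0 Mpb tail.
pose J (j : 'I_n) : {set 'I_p * 'I_n} := [set (i, j) | i : 'I_p].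
have injJ j : injective (fun i : 'I_p => (i, j)) by move=> i i' [].
have cJ j : #|J j| = p by rewrite card_imset ?card_ord//; exact: injJ.
have JE j w : \sum_(ij in J j) X ij.1 ij.2 w ^+ 2 = \sum_i X i j w ^+ 2.
  by rewrite big_imset//= => i i' _ _; exact: injJ.
pose E j := [set w | M%:R + #|J j|%:R <= \sum_(ij in J j) X ij.1 ij.2 w ^+ 2].
have b0 : 0 <= b by rewrite (le_trans _ Mpb)// addr_ge0.
apply: le_trans (union_bound P predT _ E _ _ _) _.
- by apply: measurable_set_lt => //; exact: measurable_Tmax_entries.
- move=> j; rewrite /E; under eq_set do rewrite JE.
  apply: measurable_set_le => //; apply: measurable_sum => i.
  exact: measurable_funX.
- move=> w /= lt_T; apply: contrapT => nE.
  suff : Tmax k (\matrix_(i, j) X i j w) <= k%:R * b by rewrite leNgt lt_T.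
  apply: Tmax_le => // j; rewrite leNgt; apply/negP => bj; apply: nE.
  exists j => //; rewrite /E/= JE cJ (le_trans Mpb)// (le_trans (ltW bj))//.
  by apply: ler_sum => i _; rewrite mxE.
rewrite -[X in X%:R * _]card_ord mulr_natl -sumr_const -sumEFin.
apply: lee_sum => j _; rewrite -[X in _ ^+ X](cJ j).
exact: (sum_sqr_tail P _ _ _ _ _ M indX A0 s0 r0 (fun ij m _ => tail ij.1 ij.2 m)).
Qed.

(** Cut the columns into k disjoint blocks of n %/ k columns. If every block
    contains an entry of row i whose square exceeds x, these k entries force the
    maximum above k x; otherwise some block has only small entries in row i, which
    is unlikely by independence. *)
Lemma Tmax_lower_tail {R : realType} {d : measure_display}
    {T : measurableType d} {P : probability T R} {p n k : nat}
    (X : 'I_p -> 'I_n -> {RV P >-> R}) (i : 'I_p) (x q : R) :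
  (0 < k)%N -> mutually_independent (fun ij : 'I_p * 'I_n => X ij.1 ij.2) ->
  0 <= x -> (forall j, (q%:E <= P [set w | (x < X i j w ^+ 2)%R])%E) ->
  (P [set w | (Tmax k (\matrix_(i, j) X i j w) <= k%:R * x)%R]
    <= (k%:R * expR (- q) ^+ (n %/ k))%:E)%E.
Proof.
move=> k_gt0 indX x0 tail; set m := (n %/ k)%N.
have lt_block (r : 'I_k) (l : 'I_m) : (r * m + l < n)%N.
  apply: (@leq_trans (k * m)); last by rewrite mulnC leq_trunc_div.
  by rewrite (@leq_trans (r.+1 * m))// ?leq_mul2r ?ltn_ord ?orbT// mulSn addnC ltn_add2r.
(* The r-th block of columns is the interval of length m starting at r m. *)
pose col r l : 'I_n := Ordinal (lt_block r l).
pose J (r : 'I_k) : {set 'I_p * 'I_n} := [set (i, col r l) | l : 'I_m].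
have cJ r : #|J r| = m.
  by rewrite card_imset ?card_ord// => l l' [] /addnI /val_inj.
pose E r := [set w | forall ij, ij \in J r -> X ij.1 ij.2 w ^+ 2 <= x].
apply: le_trans (union_bound P predT _ E _ _ _) _.
- by apply: measurable_set_le => //; exact: measurable_Tmax_entries.
- move=> r; apply: (measurable_rectangle (fun ij => X ij.1 ij.2 : T -> R) _
    (fun=> [set y | y ^+ 2 <= x])) => // ij.
  by apply: measurable_set_le => //; exact: measurable_funX.
- move=> w /= T_le; apply: contrapT => nE.
  have big r : exists l, x < X i (col r l) w ^+ 2.
    apply: contrapT => nb; apply: nE; exists r => // ij /imsetP[l _ ->]/=.
    by rewrite leNgt; apply/negP => xl; apply: nb; exists l.
  have [f fP] := choice big.
  have inj_f : injective (fun r => col r (f r)).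
    move=> r r' [] /(congr1 (fun a => a %/ m)%N).
    have m0 : (0 < m)%N by apply: leq_ltn_trans (ltn_ord (f r)).
    by rewrite !divnMDl// !divn_small// !addn0 => /val_inj.
  move: T_le; apply/negP; rewrite -ltNge.
  apply: (Tmax_gt _ i [set col r (f r) | r : 'I_k]) => //.
    by rewrite card_imset ?card_ord.
  by move=> j /imsetP[r _ ->]; rewrite mxE.
rewrite -[X in X%:R * _]card_ord mulr_natl -sumr_const -sumEFin.
apply: lee_sum => r _; rewrite -[X in _ ^+ X](cJ r).
by apply: all_small_le => // ij /imsetP[l _ ->]; exact: tail.
Qed.

(** * Tails of the common law *)

(** The existence of the limit kappa, unfolded: eventually the tail lies
    between exponentials with any rates a < kappa < b. *)
Lemma tail_bounds {R : realType} {d : measure_display} {T : measurableType d}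
    (P : probability T R) (xi : {RV P >-> R}) (kappa a b : R) :
  (- lne (P [set w | (x < xi w ^+ 2)%R]) * (x^-1)%:E)%E @[x --> +oo%R]
    --> kappa%:E ->
  a < kappa < b ->
  exists2 x0, 0 < x0 & forall x, x0 <= x ->
    ((expR (- (b * x)))%:E <= P [set w | (x < xi w ^+ 2)%R] <= (expR (- (a * x)))%:E)%E.
Proof.
move=> /fine_cvgP[ffin fcvg] /andP[ak kb].
have [x0 [_ x0P]] : \forall x \near +oo,
  ((expR (- (b * x)))%:E <= P [set w | (x < xi w ^+ 2)%R] <= (expR (- (a * x)))%:E)%E.
  near=> x.
  have x_gt0 : 0 < x by near: x; exact: nbhs_pinfty_gt (num_real 0).
  have vfin : (- lne (P [set w | (x < xi w ^+ 2)%R]) * (x^-1)%:E)%E \is a fin_num.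
    by near: x; exact: ffin.
  have : a < fine (- lne (P [set w | (x < xi w ^+ 2)%R]) * (x^-1)%:E)%E < b.
    apply/andP; split; near: x; [exact: cvgr_gt fcvg _ ak|exact: cvgr_lt fcvg _ kb].
  move: vfin; have : P [set w | (x < xi w ^+ 2)%R] \is a fin_num.
    by apply: fin_num_measure; apply: measurable_set_lt => //; exact: measurable_funX.
  have : (0 <= P [set w | (x < xi w ^+ 2)%R])%E by exact: measure_ge0.
  case: (P _) => [v| |]//; rewrite lee_fin le_eqVlt => /orP[/eqP <-|v0] _.
    (* A null tail would make the quotient infinite. *)
    by rewrite le0_lneNy// mulyr gtr0_sg ?invr_gt0// mul1e.
  rewrite lne_EFin// => _ /=.
  rewrite ltr_pdivlMr// ltr_pdivrMr// !lee_fin => /andP[av vb].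
  by rewrite -[v]lnK ?posrE// !ler_expR; apply/andP; split; lra.
exists (Num.max 1 (x0 + 1)); first by rewrite lt_max ltr01.
by move=> x; rewrite ge_max => /andP[_ x0x]; apply: x0P; rewrite (lt_le_trans _ x0x)// ltrDl.
Unshelve. all: by end_near. Qed.

(** Below kappa the exponential bound holds for all integers m, not only large
    ones, at the price of the constant A; the shift by one turns the strict
    inequality of the tail into a weak one. *)
Lemma sqr_tail_exponential {R : realType} {d : measure_display} {T : measurableType d}
    (P : probability T R) (xi : {RV P >-> R}) (kappa s : R) :
  (- lne (P [set w | (x < xi w ^+ 2)%R]) * (x^-1)%:E)%E @[x --> +oo%R]
    --> kappa%:E ->
  0 <= s < kappa ->
  exists2 A : R, 0 <= A & forall m : nat,
    (P [set w | (m%:R <= xi w ^+ 2)%R] <= (A * expR (- (s * m%:R)))%:E)%E.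
Proof.
move=> hk /andP[s0 sk].
have [|x0 x0_gt0 x0P] := tail_bounds P xi kappa s (kappa + 1) hk.
  by rewrite sk ltrDl ltr01.
exists (expR (s * (x0 + 1))); first exact: expR_ge0.
move=> m; rewrite -expRD.
have mX2 : measurable_fun setT (fun w => xi w ^+ 2) by exact: measurable_funX.
have mm : measurable [set w | m%:R <= xi w ^+ 2] by exact: measurable_set_le.
have [mx|xm] := leP m%:R (x0 + 1).
  apply: le_trans (probability_le1 P mm) _; rewrite lee_fin -[leLHS]expR0 ler_expR.
  by rewrite -mulrBr mulr_ge0// subr_ge0.
have /x0P/andP[_] : x0 <= m%:R - 1 by lra.
move=> h; apply: le_trans (le_trans h _).
  apply: le_measure; rewrite ?inE//; first exact: measurable_set_lt.
  by move=> w /= /(lt_le_trans _); apply; rewrite ltrBlDr ltrDl.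
rewrite lee_fin ler_expR -subr_ge0.
have -> : s * (x0 + 1) + - (s * m%:R) - - (s * (m%:R - 1)) = s * x0 by ring.
by rewrite mulr_ge0// ltW.
Qed.

(** * Asymptotics in the number of columns *)

Lemma ln_nat_ge {R : realType} (B : R) : \forall n \near \oo, B <= ln n%:R.
Proof.
near=> n.
have Bn : expR B <= n%:R by near: n; exact: nbhs_infty_ger.
by rewrite -[leLHS]expRK ler_ln// posrE ?expR_gt0// (lt_le_trans (expR_gt0 B)).
Unshelve. all: by end_near. Qed.

Lemma cvg_expRN_ln {R : realType} (K eta : R) : 0 < eta ->
  K * expR (- (eta * ln n%:R)) @[n --> \oo] --> (0 : R).
Proof.
move=> eta0; rewrite -[X in _ --> X](mulr0 K); apply: cvgMr.
apply/cvgr0Pnorm_le => e e0; near=> n.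
rewrite ger0_norm ?expR_ge0// -[leRHS]lnK ?posrE// ler_expR lerNl mulrC -ler_pdivrMr//.
by near: n; exact: ln_nat_ge.
Unshelve. all: by end_near. Qed.

(** The bound of [Tmax_upper_tail] at b = u log n. With M = u log n - p - O(1)
    its exponent is (1 - s u) log n + O(p + 1), and p = o(log n). *)
Lemma upper_rate {R : realType} (p : nat -> nat) (C s u : R) :
  (p n)%:R / ln (n%:R : R) @[n --> \oo] --> (0 : R) ->
  0 <= C -> 0 < s -> 0 < u -> 1 < s * u ->
  exists K eta : R, 0 < eta /\ \forall n \near \oo, exists M : nat,
    M%:R + (p n)%:R <= u * ln n%:R /\
    n%:R * (expR (- (s * M%:R)) * C ^+ p n) <= K * expR (- (eta * ln n%:R)).
Proof.
move=> hp C0 s0 u0 su; pose eta := (s * u - 1) / 2.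
have eta0 : 0 < eta by rewrite /eta; lra.
have sC : 0 < s + C by lra.
exists (expR s), eta; split=> //; near=> n.
have L1 : 1 <= ln n%:R :> R by near: n; exact: ln_nat_ge.
have L0 : 0 < ln n%:R :> R by lra.
have n0 : (0 < n)%N by near: n; exact: nbhs_infty_gt.
have pu : (p n)%:R <= u * ln n%:R.
  by rewrite -ler_pdivrMr//; near: n; exact: cvgr_le hp _ u0.
have pe : (s + C) * (p n)%:R <= eta * ln n%:R.
  rewrite mulrC -ler_pdivlMr// mulrAC -ler_pdivrMr//; near: n.
  by apply: cvgr_le hp _ _; rewrite divr_gt0.
exists (Num.truncn (u * ln n%:R - (p n)%:R)); split.
  by rewrite -lerBrDr truncn_le subr_ge0.
set M := Num.truncn _.
have MS : u * ln n%:R - (p n)%:R < M%:R + 1 by rewrite natr1 truncnS_gt.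
have nE : n%:R = expR (ln n%:R) :> R by rewrite lnK// posrE ltr0n.
have Cp : C ^+ p n <= expR (C * (p n)%:R).
  rewrite expRM_natr lerXn2r ?nnegrE ?expR_ge0//.
  by rewrite (le_trans _ (expR_ge1Dx C))// lerDr.
rewrite {1}nE -expRD.
apply: (@le_trans _ _ (expR (ln n%:R) * (expR (- (s * M%:R)) * expR (C * (p n)%:R)))).
  by rewrite !ler_wpM2l ?expR_ge0.
rewrite -!expRD ler_expR.
have sM : s * (u * ln n%:R - (p n)%:R) <= s * (M%:R + 1) by rewrite ler_wpM2l// ltW.
have E2 : 2 * eta = s * u - 1 by rewrite /eta; field.
have E3 : 2 * eta * ln n%:R = (s * u - 1) * ln n%:R by rewrite E2.
nra.
Unshelve. all: by end_near. Qed.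

(** The bound of [Tmax_lower_tail] at x = c log n. The expected number of
    exceedances in a block is at least n^(1 - b c) / (2 k), which tends to
    infinity, and exp (- y) <= 1 / y. *)
Lemma lower_rate {R : realType} (k : nat) (b c : R) :
  (0 < k)%N -> b * c < 1 ->
  exists K eta : R, 0 < eta /\ \forall n \near \oo,
    k%:R * expR (- expR (- (b * (c * ln n%:R)))) ^+ (n %/ k)
      <= K * expR (- (eta * ln n%:R)).
Proof.
move=> k0 bc; pose eta := 1 - b * c.
have eta0 : 0 < eta by rewrite subr_gt0.
have kR : 0 < k%:R :> R by rewrite ltr0n.
exists (2 * k%:R ^+ 2), eta; split=> //; near=> n.
have nk : (k <= n)%N by near: n; exact: nbhs_infty_ge.
have n0 : (0 < n)%N by rewrite (leq_trans _ nk).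
have nE : n%:R = expR (ln n%:R) :> R by rewrite lnK// posrE ltr0n.
set q := expR (- (b * _)); set m := (n %/ k)%N.
(* Already for k <= n the integer quotient is at least n / (2 k). *)
have mn : n%:R <= 2 * k%:R * m%:R :> R.
  rewrite -!natrM ler_nat {1}(divn_eq n k) -/m -mulnA (mulnC k m) mul2n -addnn.
  rewrite leq_add2l (leq_trans (ltnW (ltn_pmod n k0)))// leq_pmull//.
  by rewrite divn_gt0.
have qm : expR (eta * ln n%:R) <= 2 * k%:R * (q * m%:R).
  have -> : expR (eta * ln n%:R) = q * n%:R.
    by rewrite [in RHS]nE -expRD; congr expR; rewrite /eta; ring.
  by rewrite [leRHS]mulrCA ler_wpM2l ?expR_ge0.
rewrite -expRM_natr mulNr.
have -> : 2 * k%:R ^+ 2 * expR (- (eta * ln n%:R)) =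
  k%:R * (2 * k%:R * expR (- (eta * ln n%:R))) by ring.
rewrite ler_wpM2l// !expRN -[leLHS]mul1r ler_pdivrMr ?expR_gt0//.
rewrite mulrAC ler_pdivlMr ?expR_gt0// mul1r (le_trans qm)//.
rewrite ler_wpM2l ?mulr_ge0//.
by rewrite (le_trans _ (expR_ge1Dx _))// lerDr.
Unshelve. all: by end_near. Qed.

Theorem theorem7 (R : realType) (k : nat) (hk : (1 <= k)%N)
  (d0 : measure_display) (T0 : measurableType d0) (P0 : probability T0 R)
  (xi : {RV P0 >-> R})
  (hmean : ('E_P0[xi] = 0)%E)
  (hvar : ('E_P0[fun w => (xi w ^+ 2)%R] = 1)%E)
  (t0 : R) (ht0 : 0 < t0)
  (hexp : ('E_P0[fun w => expR (t0 * xi w ^+ 2)%R] < +oo)%E)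
  (p : nat -> nat) (hp : forall n, (1 <= n)%N -> (1 <= p n)%N)
  (hplog : (p n)%:R / ln (n%:R : R) @[n --> \oo] --> (0 : R))
  (kappa : R) (hkappa0 : 0 < kappa)
  (hkappa : (- lne (P0 [set w | (x < xi w ^+ 2)%R]) * (x^-1)%:E)%E @[x --> +oo%R]
              --> kappa%:E)
  (d : nat -> measure_display) (T : forall n, measurableType (d n))
  (P : forall n, probability (T n) R)
  (X : forall n, 'I_(p n) -> 'I_n -> {RV (P n) >-> R})
  (hindep : forall n,
     mutually_independent (fun ij : 'I_(p n) * 'I_n => X n ij.1 ij.2))
  (hlaw : forall n i j, same_law (X n i j) xi) :
  cvg_in_probability P
    (fun n w => Tmax k (\matrix_(i, j) X n i j w) / (k%:R * ln n%:R))
    kappa^-1.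
Proof.
move=> e e0.
(* The deviation event forces k (log n) u < T or T <= k (log n) c. For large e
   the level kappa^-1 - e is negative, so c is cut off at kappa^-1 / 2. *)
pose u := kappa^-1 + e.
pose c := kappa^-1 - Num.min e (kappa^-1 / 2).
have ki : 0 < kappa^-1 by rewrite invr_gt0.
have [u0 c0 c1 ce] : [/\ 0 < u, 0 < c, c < kappa^-1 & kappa^-1 - e <= c].
  have m0 : 0 < Num.min e (kappa^-1 / 2) by rewrite lt_min e0 divr_gt0.
  have me : Num.min e (kappa^-1 / 2) <= e by rewrite ge_min lexx.
  have mk : Num.min e (kappa^-1 / 2) <= kappa^-1 / 2 by rewrite ge_min lexx orbT.
  by rewrite /u /c; split; lra.
have uk : u^-1 < kappa by rewrite -[kappa]invrK ltf_pV2 ?posrE// /u ltrDl.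
have ck : kappa < c^-1 by rewrite -[kappa]invrK ltf_pV2 ?posrE.
have uV : 0 < u^-1 by rewrite invr_gt0.
(* Then u^-1 < s < s + r < kappa < b < c^-1: the decay rates s + r and b are
   available on either side of kappa, while s u > 1 and b c < 1. *)
pose s := (2 * u^-1 + kappa) / 3; pose r := (kappa - u^-1) / 3.
pose b := (kappa + c^-1) / 2.
have [s0 r0 srk us] : [/\ 0 < s, 0 < r, s + r < kappa & u^-1 < s].
  by rewrite /r /s; split; lra.
have [bk bc] : kappa < b /\ b < c^-1 by rewrite /b; split; lra.
have su : 1 < s * u by rewrite -ltr_pdivrMr// mul1r.
have bc1 : b * c < 1 by rewrite -ltr_pdivlMr// mul1r.
have [|A A0 tailU] := sqr_tail_exponential P0 xi kappa (s + r) hkappa.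
  by rewrite srk addr_ge0// ltW.
have [|x0 x0_gt0 tailL] := tail_bounds P0 xi kappa 0 b hkappa.
  by rewrite hkappa0.
pose C := A / (1 - expR (- r)).
have C0 : 0 <= C by rewrite divr_ge0// subr_ge0 expR_le1 oppr_le0 ltW.
have [K1 [eta1 [eta1_gt0 rateU]]] := upper_rate p C s u hplog C0 s0 u0 su.
have [K2 [eta2 [eta2_gt0 rateL]]] := lower_rate k b c hk bc1.
have lawU n i j (m : nat) : P n [set w | m%:R <= X n i j w ^+ 2] =
    P0 [set w | m%:R <= xi w ^+ 2].
  apply: (hlaw n i j [set y | m%:R <= y ^+ 2]).
  by apply: measurable_set_le => //; exact: measurable_funX.
have lawL n i j (x : R) : P n [set w | x < X n i j w ^+ 2] =
    P0 [set w | x < xi w ^+ 2].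
  apply: (hlaw n i j [set y | x < y ^+ 2]).
  by apply: measurable_set_lt => //; exact: measurable_funX.
apply: (@squeeze_cvge _ _ _ _ (cst 0%E) _
  (fun n => (K1 * expR (- (eta1 * ln n%:R)) + K2 * expR (- (eta2 * ln n%:R)))%:E)).
- near=> n; rewrite measure_ge0/=.
  have L0 : 0 < ln n%:R :> R.
    by apply: (@lt_le_trans _ _ 1) => //; near: n; exact: ln_nat_ge.
  have n0 : (0 < n)%N by near: n; exact: nbhs_infty_gt.
  have kL : 0 < k%:R * ln n%:R :> R by rewrite mulr_gt0// ltr0n.
  pose TX w := Tmax k (\matrix_(i, j) X n i j w).
  have mT : measurable_fun setT TX by exact: measurable_Tmax_entries.
  pose U := [set w | k%:R * (u * ln n%:R) < TX w].
  pose V := [set w | TX w <= k%:R * (c * ln n%:R)].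
  have mU : measurable U by exact: measurable_set_lt.
  have mV : measurable V by exact: measurable_set_le.
  have PU : (P n U <= (K1 * expR (- (eta1 * ln n%:R)))%:E)%E.
    have [M [Mpu rate]] : exists M : nat, M%:R + (p n)%:R <= u * ln n%:R /\
        n%:R * (expR (- (s * M%:R)) * C ^+ p n) <= K1 * expR (- (eta1 * ln n%:R)).
      by near: n.
    apply: le_trans (Tmax_upper_tail (X n) A s r _ M hk (hindep n) A0 (ltW s0) r0 Mpu _) _.
      by move=> i j m; rewrite lawU.
    by rewrite lee_fin.
  have PV : (P n V <= (K2 * expR (- (eta2 * ln n%:R)))%:E)%E.
    have rate : k%:R * expR (- expR (- (b * (c * ln n%:R)))) ^+ (n %/ k)
      <= K2 * expR (- (eta2 * ln n%:R)) by near: n.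
    have cx : x0 <= c * ln n%:R.
      by rewrite mulrC -ler_pdivrMr//; near: n; exact: ln_nat_ge.
    apply: le_trans (Tmax_lower_tail (X n) (Ordinal (hp n n0)) _
      (expR (- (b * (c * ln n%:R)))) hk (hindep n) _ _) _.
    + by rewrite mulr_ge0// ltW.
    + by move=> j; rewrite lawL; have /andP[] := tailL _ cx.
    + by rewrite lee_fin.
  (* The value of P n on a set that is not measurable is arbitrary, hence the
     measurability of T is used to compare the deviation event with U and V. *)
  apply: (@le_trans _ _ (P n (U `|` V))).
    apply: le_measure; rewrite ?inE//; [|exact: measurableU|].
      apply: measurable_set_lt => //; apply: measurableT_comp => //.
      by apply: measurable_funB => //; apply: measurable_funM.
    move=> w /=; rewrite -/(TX w) => eT.
    have TE : TX w = k%:R * ln n%:R * (TX w / (k%:R * ln n%:R)).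
      by rewrite mulrC divfK// gt_eqF.
    have [Tu|uT] := leP (TX w / (k%:R * ln n%:R)) u.
      right; rewrite /V/= TE (mulrC c) [leRHS]mulrA ler_wpM2l ?(ltW kL)//; move: eT.
      by rewrite ltNge ler_distl -/u Tu andbT -ltNge => xc; rewrite (le_trans (ltW xc)).
    by left; rewrite /U/= TE (mulrC u) [ltLHS]mulrA ltr_pM2l.
  apply: le_trans (measureU2 _ mU mV) _.
  by rewrite EFinD leeD.
- exact: cvg_cst.
- apply: cvg_EFin; first by near=> n.
  rewrite -[X in _ --> X](addr0 0).
  by apply: cvgD; exact: cvg_expRN_ln.
Unshelve. all: by end_near. Qed.
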